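(* For integers $i \ge 4$ and $m,k \ge 4$ define $$w_4(m,k) = \binom{m+k-6}{k-2} + \binom{m+k-7}{k-3} + 2\binom{m+k-8}{k-4},$$ and for $i \ge 5$, $w_i(m,k) = 0$ if $k < i$ and $w_i(m,k) = (i-1)\binom{m+k-i-4}{k-i}$ if $k \ge i$. Let $g(m,l) = \sum_{i=4}^{\infty} w_i(m,l)$. Let $n \ge 6$ and let $S$ be a set of $\binom{2n-6}{n-3} + g(n,n-2) + 1$ points. Then $S$ contains an $n$-cup, or an $(n-1)$-cap, or $n$ points forming a convex $n$-gon.
   Context: All point sets are finite sets in the plane in general position (no three collinear), with pairwise distinct $x$-coordinates. A set of $n$ points, listed as $(x_1,y_1),\dots,(x_n,y_n)$ with $x_1<\dots<x_n$, is an $n$-cup if $\frac{y_2-y_1}{x_2-x_1} < \dots < \frac{y_n-y_{n-1}}{x_n-x_{n-1}}$, and an $n$-cap if $\frac{y_2-y_1}{x_2-x_1} > \dots > \frac{y_n-y_{n-1}}{x_n-x_{n-1}}$. (The quantity $\binom{2n-6}{n-3}$ is the paper's $f(n-1,n-1)$, the maximum size of a set with no $(n-1)$-cup and no $(n-1)$-cap.) *)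

(* Defs.v *)
From mathcomp Require Import all_boot all_order all_algebra finmap.
From mathcomp Require Import classical_sets reals convex.

Set Implicit Arguments.
Unset Strict Implicit.
Unset Printing Implicit Defensive.

Import Order.TTheory GRing.Theory Num.Theory.

Local Open Scope fset_scope.
Local Open Scope ring_scope.

Section Plane.
Variable R : realType.

Definition xcoord (p : 'rV[R]_2) : R := p 0 0.
Definition ycoord (p : 'rV[R]_2) : R := p 0 1.

Definition collinear (p q r : 'rV[R]_2) : Prop :=
  exists a b c : R, (a != 0 \/ b != 0) /\
    forall t, t \in [:: p; q; r] -> a * xcoord t + b * ycoord t = c.

Definition general_position (S : {fset 'rV[R]_2}) : Prop :=
  forall p q r, p \in S -> q \in S -> r \in S -> uniq [:: p; q; r] ->
    ~ collinear p q r.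

Definition distinct_xcoords (S : {fset 'rV[R]_2}) : Prop :=
  {in S &, injective xcoord}.

Definition slope (p q : 'rV[R]_2) : R :=
  (ycoord q - ycoord p) / (xcoord q - xcoord p).

(* The slopes between consecutive points of s. *)
Definition slopes (s : seq 'rV[R]_2) : seq R :=
  if s is p :: s' then pairmap slope p s' else [::].

Definition increasing_listing (s : seq 'rV[R]_2) (T : {fset 'rV[R]_2}) :=
  sorted (fun p q => xcoord p < xcoord q) s /\ T =i s.

Definition is_cup (n : nat) (T : {fset 'rV[R]_2}) : Prop :=
  exists s : seq 'rV[R]_2,
    [/\ increasing_listing s T, size s = n & sorted <%R (slopes s)].

Definition is_cap (n : nat) (T : {fset 'rV[R]_2}) : Prop :=
  exists s : seq 'rV[R]_2,
    [/\ increasing_listing s T, size s = n & sorted >%R (slopes s)].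

Definition convex_hull (A : set 'rV[R]_2) : set 'rV[R]_2 :=
  smallest (@convex_set R 'rV[R]_2) A.

(* The points of T are the n vertices of a convex polygon: none of them lies in
   the convex hull of the others. *)
Definition is_convex_gon (n : nat) (T : {fset 'rV[R]_2}) : Prop :=
  #|` T| = n /\
  forall p, p \in T -> ~ convex_hull [set q | q \in (T `\ p)%fset]%classic p.

End Plane.

Local Open Scope nat_scope.

(* Meaningful for i, m, k >= 4, in which case no subtraction of naturals in a
   branch that is selected truncates, for i = 4 as for 4 < i <= k. *)
Definition w (i m k : nat) : nat :=
  if i == 4 then
    'C(m + k - 6, k - 2) + 'C(m + k - 7, k - 3) + 2 * 'C(m + k - 8, k - 4)
  else if k < i then 0
  else (i - 1) * 'C(m + k - i - 4, k - i).

(* The infinite series over i >= 4, whose terms vanish for i > l when l >= 4: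
   see g_eventually. *)
Definition g (m l : nat) : nat := \sum_(4 <= i < l.+1) w i m l.

Lemma g_eventually (m l N : nat) :
  4 <= l -> l < N -> \sum_(4 <= i < N) w i m l = g m l.
Proof.
move=> l4 lN; rewrite (big_cat_nat (n := l.+1)) //=; last exact: leqW.
rewrite [X in _ + X]big_nat [X in _ + X]big1 ?addn0// => i /andP[li _].
by rewrite /w gtn_eqF ?li// (leq_ltn_trans l4).
Qed.

(* Main.v *)
(** Suppose that [S] has no [n]-cup, no [(n-1)]-cap and no convex [n]-gon, and
split it greedily into [B], without [(n-1)]-cup, and [A], each point of which is
the right end of an [(n-1)]-cup whose other points lie in [B]. By Erdős and
Szekeres [B] has at most C(2n-6,n-3) points. A cap starting in [A] extends to the
left in [S], since the second last point of the cup ending at its first point can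
be prepended; so [A] has no [(n-2)]-cap.

In [A], no [(n-1)]-cup [y z w ..] starts with the last edge of an [(n-3)]-cap
[.. x y z]. Indeed consider the cup [c1 c2 c3 .. z] of [n-1] points ending at
[z], and prepend a point to the cap. A cup plus a point above the chord of its
ends is in convex position, and this forces [y] to be to the left of [c1]. Then
[c2] is below the line [y z], as otherwise [c1 c2 z w ..] is an [n]-cup. Comparing
the slopes of [y c1], [y c2], [y c3] and [y z] yields an [n]-cup starting
[y c1 c2], an [(n-1)]-cap ending [x y c1 c2] or [x y c2 c3], or the [n]-gon made
of [c1] and the cup [y c2 c3 .. z].

The right ends of [(n-3)]-caps of [A], the left ends of [(n-1)]-cups of [A] and
the remaining points thus form three sets, of sizes at most
C(2n-8,n-4), C(2n-8,n-2) and C(2n-8,n-3), with sum at most [g n (n-2)]. *)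

Require Import Defs.
From mathcomp Require Import all_boot all_order all_algebra finmap.
From mathcomp Require Import boolp classical_sets reals convex interval_inference.
From mathcomp Require Import ring zify.

Set Implicit Arguments.
Unset Strict Implicit.
Unset Printing Implicit Defensive.

Import Order.TTheory GRing.Theory Num.Theory.

Local Open Scope nat_scope.

(** * The binomial estimate *)

Lemma sum_diag_bin a K : \sum_(j < K.+1) 'C(a + j, j) = 'C(a + K.+1, K).
Proof.
elim: K => [|K IH]; first by rewrite big_ord1 /= !bin0.
by rewrite big_ord_recr /= IH [in RHS]addnS binS addnC.
Qed.

(** The weight [K.+1 - j] counts the partial sums that contain the term [j], so this is the
    hockey-stick identity [sum_diag_bin] summed once more. *)
Lemma sum_diag_bin_weighted a K :
  \sum_(j < K.+1) (K.+1 - j) * 'C(a + j, j) = 'C(a + K.+2, K).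
Proof.
elim: K => [|K IH]; first by rewrite big_ord1 /= !bin0.
rewrite [in RHS]addnS binS -IH -sum_diag_bin big_ord_recr [in RHS]big_ord_recr /=.
rewrite subSnn mul1n addnAC -big_split /=; congr addn.
by apply: eq_bigr => j _; rewrite [in LHS]subSn ?mulSn //; apply: ltnW.
Qed.

(** The terms with i > 4 are summed backwards, with j = k + 5 - i. The factor i - 1 is (k + 1 - j) +
    3, one summand for each diagonal identity. *)
Lemma gE k : g (k + 7) (k + 5) =
  'C(k.*2 + 6, k + 3) + 'C(k.*2 + 5, k + 2) + 2 * 'C(k.*2 + 4, k + 1)
  + 'C(k.*2 + 5, k) + 3 * 'C(k.*2 + 4, k).
Proof.
rewrite /g big_ltn; last by rewrite addnC.
rewrite -[RHS]addnA; congr addn.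
  rewrite /w /=.
  have -> : k + 7 + (k + 5) - 6 = k.*2 + 6 by lia.
  have -> : k + 7 + (k + 5) - 7 = k.*2 + 5 by lia.
  have -> : k + 7 + (k + 5) - 8 = k.*2 + 4 by lia.
  have -> : k + 5 - 2 = k + 3 by lia.
  have -> : k + 5 - 3 = k + 2 by lia.
  by have -> : k + 5 - 4 = k + 1 by lia.
rewrite -[4.+1]add0n big_addn (_ : (k + 5).+1 - 5 = k.+1); last by lia.
rewrite big_mkord (reindex_inj rev_ord_inj) /=.
transitivity (\sum_(j < k.+1) ((k.+1 - j) * 'C(k + 3 + j, j) + 3 * 'C(k + 3 + j, j))).
  apply: eq_bigr => -[j /= jk] _; rewrite subSS /w -mulnDl.
  case: eqP => [|_]; first by lia.
  case: ltnP => [|_]; first by lia.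
  have -> : k + 7 + (k + 5) - (k - j + 5) - 4 = k + 3 + j by lia.
  have -> : k + 5 - (k - j + 5) = j by lia.
  by congr (_ * _); lia.
rewrite big_split /= sum_diag_bin_weighted -big_distrr /= sum_diag_bin.
by congr ('C(_, _) + _ * 'C(_, _)); lia.
Qed.

(** At k = 0 both sides are 11. With k + 1 for k, symmetry and Pascal's rule reduce both sides to
    the same binomials, and the right one exceeds the left one by C(2k+4, k). *)
Lemma g_lower k :
  'C(k.*2 + 4, k + 2) + 'C(k.*2 + 4, k + 3) + 'C(k.*2 + 4, k + 4)
  <= g (k + 6) (k + 4).
Proof.
case: k => [|k]; first by rewrite /g big_nat1.
have -> : g (k.+1 + 6) (k.+1 + 4) = g (k + 7) (k + 5) by congr g; lia.
have -> : k.+1.*2 + 4 = k.*2 + 6 by lia.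
have -> : k.+1 + 2 = k + 3 by lia.
rewrite gE.
have -> : 'C(k.*2 + 6, k.+1 + 3) = 'C(k.*2 + 6, k + 2).
  by rewrite -bin_sub; [congr 'C(_, _)|]; lia.
have -> : 'C(k.*2 + 6, k.+1 + 4) = 'C(k.*2 + 6, k + 1).
  by rewrite -bin_sub; [congr 'C(_, _)|]; lia.
have pascal N j : 'C(N.+1, j.+1) = 'C(N, j.+1) + 'C(N, j) by exact: binS.
rewrite !addnS !addn0; move: (k.*2) => N.
have := (pascal N.+4.+1 k.+1, pascal N.+4.+1 k, pascal N.+4 k).
case=> -[-> ->] ->.
move: 'C(_, k.+3) 'C(_, k.+2) 'C(_, k.+1) 'C(N.+4.+1, k) 'C(N.+4, k) => a b c d e.
by clear; lia.
Qed.

(** * Cups and caps as monochromatic chains *)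

Section MonochromaticChains.
Variables (T : eqType) (lt : rel T) (col : T -> T -> T -> bool).
Hypotheses (lt_trans : transitive lt) (lt_irr : irreflexive lt).

(** Only consecutive triples are constrained, as with consecutive slopes, so prolonging a chain at
    either end is a condition on one triple. *)
Fixpoint mono (c : bool) (s : seq T) : bool :=
  match s with
  | p :: ((q :: r :: _) as s') => (col p q r == c) && mono c s'
  | _ => true
  end.

(* For [col p q r] := "[p q r] turns left", [chain true] is a cup and
   [chain false] a cap. *)
Definition chain c (X s : seq T) := [&& sorted lt s, all [in X] s & mono c s].

Definition chain_free c N (X : seq T) :=
  forall s, chain c X s -> size s = N -> False.

Lemma mono_rcons c s p q r :
  mono c (s ++ [:: p; q; r]) = mono c (s ++ [:: p; q]) && (col p q r == c).
Proof.
elim: s => [|a s]; first by rewrite /= andbT.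
by case: s => [|b [|d s]] /= IH; rewrite ?{}IH ?andbT ?andbA.
Qed.

Lemma mono_cat c s t : mono c (s ++ t) -> mono c t.
Proof.
elim: s => [//|a s IH]; rewrite cat_cons => H; apply: IH.
by case: (s ++ t) H => [|b [|d u]] //= /andP[].
Qed.

Lemma chain_cons c X p q r s :
  chain c X [:: p, q, r & s] =
  [&& p \in X, lt p q, col p q r == c & chain c X [:: q, r & s]].
Proof.
rewrite /chain /=; case: (lt p q) => //=; case: (lt q r) => //=; rewrite ?andbF //.
case: (p \in X) => //=; rewrite ?andbF //.
by rewrite [in RHS]andbCA; congr andb; rewrite [RHS]andbCA.
Qed.

Lemma chain_rcons c X s p q r :
  chain c X (s ++ [:: p; q; r]) =
  [&& r \in X, lt q r, col p q r == c & chain c X (s ++ [:: p; q])].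
Proof.
rewrite /chain mono_rcons !all_cat.
have -> : sorted lt (s ++ [:: p; q; r]) = sorted lt (s ++ [:: p; q]) && lt q r.
  by case: s => [|a s] /=; rewrite ?cat_path /= ?andbT ?andbA.
move=> /=; rewrite !andbT.
by case: (lt q r); case: (r \in X); case: (col p q r == c);
  rewrite /= ?andbT ?andbF //= ?andbT ?andbF.
Qed.

Lemma chain2 c X p q : lt p q -> p \in X -> q \in X -> chain c X [:: p; q].
Proof. by rewrite /chain /= => -> -> ->. Qed.

Lemma chain_behead c X s t : chain c X (s ++ t) -> chain c X t.
Proof.
case/and3P=> /cat_sorted2[_ st]; rewrite all_cat => /andP[_ tX] /mono_cat m.
by rewrite /chain st tX m.
Qed.

Lemma chain_sub c X Y s : {subset X <= Y} -> chain c X s -> chain c Y s.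
Proof.
move=> XY /and3P[sl sX sm]; apply/and3P; split=> //.
by apply: sub_all sX => p /XY.
Qed.

Lemma chain_free_sub c N X Y :
  {subset X <= Y} -> chain_free c N Y -> chain_free c N X.
Proof. by move=> XY Y0 s /(chain_sub XY); exact: Y0. Qed.

Lemma chain_mem c X s p : chain c X s -> p \in s -> p \in X.
Proof. by case/and3P=> _ /allP sX _ /sX. Qed.

Lemma chain_uniq c X s : chain c X s -> uniq s.
Proof. by case/and3P=> /(sorted_uniq lt_trans lt_irr). Qed.

(** The triple [u p v] has one colour or the other: [c] prolongs the first chain, the opposite
    colour prolongs the second. *)
Lemma chain_junction c X s u p v t :
  chain c X (s ++ [:: u; p]) -> chain (~~ c) X [:: p, v & t] ->
  chain c X (s ++ [:: u; p; v]) \/ chain (~~ c) X [:: u, p, v & t].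
Proof.
move=> Hs Ht; have Hup := chain_behead Hs.
have uX : u \in X by rewrite (chain_mem Hup) ?inE ?eqxx.
have vX : v \in X by rewrite (chain_mem Ht) ?inE ?eqxx ?orbT.
rewrite chain_rcons chain_cons Hs Ht uX vX !andbT /=.
have [/and3P[/= + _ _] /and3P[/= + _ _]] := (Hup, Ht).
rewrite andbT => -> /andP[-> _] /=.
by case: (col u p v); case: c {Hs Ht Hup}; [left|right|right|left].
Qed.

(** * Ends of chains and the Erdős-Szekeres bound *)

Definition ends c N X p := 
  exists s u, chain c X (s ++ [:: u; p]) /\ size s + 2 = N.
Definition starts c N X p := 
  exists v t, chain c X [:: p, v & t] /\ size t + 2 = N.

Lemma last2 N (s : seq T) : size s = N.+2 ->
  exists s' u p, s = s' ++ [:: u; p] /\ size s' = N.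
Proof.
case/lastP: s => // s p; rewrite size_rcons => -[].
case/lastP: s => // s u; rewrite size_rcons => -[<-].
by exists s, u, p; rewrite -!cats1 -catA.
Qed.

Lemma first2 N (s : seq T) : size s = N.+2 ->
  exists p v t, s = [:: p, v & t] /\ size t = N.
Proof. by case: s => [|p [|v t]] //= [<-]; exists p, v, t. Qed.

Definition total_on (X : seq T) :=
  {in X &, forall p q, p != q -> lt p q || lt q p}.

Lemma total_on_sub X Y : {subset X <= Y} -> total_on Y -> total_on X.
Proof. by move=> XY Y0 p q /XY pY /XY qY; exact: Y0. Qed.

Lemma free2_size c X : uniq X -> total_on X -> chain_free c 2 X -> size X <= 1.
Proof.
case: X => [|p [|q X]] //= /andP[+ _] tot free.
rewrite inE negb_or => /andP[pq _].
have [pX qX] : p \in [:: p, q & X] /\ q \in [:: p, q & X].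
  by rewrite !inE !eqxx orbT.
by case/orP: (tot p q pX qX pq) => [h|h]; case: (free _ (chain2 c h _ _)).
Qed.

Definition sel (P : T -> Prop) (X : seq T) := [seq p <- X | `[< P p >]].

Lemma mem_sel P X p : p \in sel P X -> P p /\ p \in X.
Proof. by rewrite mem_filter => /andP[/asboolP]. Qed.

Lemma sel_sub P X : {subset sel P X <= X}.
Proof. by move=> p /mem_sel[]. Qed.

Lemma size_sel P X : size X = size (sel P X) + size (sel (fun p => ~ P p) X).
Proof.
rewrite /sel !size_filter -(count_predC (fun p => `[< P p >]) X); congr addn.
by apply: eq_count => p /=; rewrite asbool_neg.
Qed.

(** The last point of such a chain would itself be an excluded end. *)
Lemma chain_free_not_ends c N X :
  chain_free c N.+2 (sel (fun p => ~ ends c N.+2 X p) X).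
Proof.
move=> s0 Hs /last2[s [u [p [def_s sz]]]]; subst s0.
have /mem_sel[+ _] : p \in sel (fun p => ~ ends c N.+2 X p) X.
  by rewrite (chain_mem Hs) // mem_cat !inE eqxx !orbT.
apply; exists s, u; split; last by rewrite sz addn2.
exact: chain_sub (@sel_sub _ _) Hs.
Qed.

Lemma chain_free_not_starts c N X :
  chain_free c N.+2 (sel (fun p => ~ starts c N.+2 X p) X).
Proof.
move=> s0 Ht /first2[p [v [t [def_s sz]]]]; subst s0.
have /mem_sel[+ _] : p \in sel (fun p => ~ starts c N.+2 X p) X.
  by rewrite (chain_mem Ht) // inE eqxx.
apply; exists v, t; split; last by rewrite sz addn2.
exact: chain_sub (@sel_sub _ _) Ht.
Qed.

Lemma uniq_sel P X : uniq X -> uniq (sel P X). Proof. exact: filter_uniq. Qed.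

Lemma total_on_sel P X : total_on X -> total_on (sel P X).
Proof. by apply: total_on_sub; apply: sel_sub. Qed.

(** In the inductive step, right ends of (k+2)-cups contain no (l+2)-cap, by [chain_junction] at its
    first point; the other points contain no (k+2)-cup. Pascal's rule adds the two bounds. *)
Theorem erdos_szekeres k l (X : seq T) : uniq X -> total_on X ->
  chain_free true k.+2 X -> chain_free false l.+2 X -> size X <= 'C(k + l, k).
Proof.
elim: k l X => [|k IHk] l X uX tX.
  by move=> cupX _; rewrite bin0; apply: free2_size cupX.
elim: l X uX tX => [|l IHl] X uX tX cupX capX.
  by rewrite addn0 binn; apply: free2_size capX.
rewrite (size_sel (ends true k.+2 X)) addSn binS leq_add //.
  rewrite -addSnnS; apply: IHl; rewrite ?uniq_sel//; first exact: total_on_sel.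
    exact: chain_free_sub (@sel_sub _ _) cupX.
  move=> s0 Ht /first2[p [v [t [def_s sz]]]]; subst s0.
  have /mem_sel[[s [u [Hs sz_s]]] _] : p \in sel (ends true k.+2 X) X.
    by rewrite (chain_mem Ht) // inE eqxx.
  have [Hv|Hu] := chain_junction Hs (chain_sub (@sel_sub _ _) Ht).
    by apply: (cupX _ Hv); rewrite size_cat /=; lia.
  by apply: (capX _ Hu) => /=; lia.
apply: IHk; rewrite ?uniq_sel//; first exact: total_on_sel.
  exact: chain_free_not_ends.
exact: chain_free_sub (@sel_sub _ _) capX.
Qed.

(** * Caps and cups sharing an edge *)

Definition shared_edge m l X := exists s y z t,
  [/\ chain false X (s ++ [:: y; z]), size s + 2 = l,
      chain true X [:: y, z & t] & size t + 2 = m].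

(* Right ends of (j+3)-caps contain no (k+2)-cup, left ends of (k+3)-cups contain
   no (j+2)-cap, as either would extend to a shared edge; the remaining points
   contain neither a (k+3)-cup nor a (j+3)-cap. *)
Lemma shared_edge_bound k j X : uniq X -> total_on X ->
  chain_free true (k + 4) X -> chain_free false (j + 4) X ->
  ~ shared_edge (k + 3) (j + 3) X ->
  size X <= 'C(k + j + 2, k) + 'C(k + j + 2, k.+1) + 'C(k + j + 2, k.+2).
Proof.
move=> uX tX cupX capX no_edge.
rewrite (size_sel (ends false j.+3 X)) -addnA leq_add //.
  rewrite -addnA addn2; apply: erdos_szekeres; rewrite ?uniq_sel//.
  - exact: total_on_sel.
  - move=> s0 Ht /first2[p [v [t [def_s sz]]]]; subst s0.
    have /mem_sel[[s [u [Hs sz_s]]] _] : p \in sel (ends false j.+3 X) X.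
      by rewrite (chain_mem Ht) // inE eqxx.
    have [Hv|Hu] := chain_junction Hs (chain_sub (@sel_sub _ _) Ht).
      by apply: (capX _ Hv); rewrite size_cat /=; lia.
    (* The last edge [u p] of the cap is the first edge of the prolonged cup. *)
    by apply: no_edge; exists s, u, p, (v :: t); split=> //=; lia.
  - by move: capX; rewrite addn4; apply: chain_free_sub; apply: sel_sub.
set Y := sel _ X; have YX : {subset Y <= X} by exact: sel_sub.
have uY : uniq Y by exact: uniq_sel.
have tY : total_on Y by exact: total_on_sub tX.
rewrite (size_sel (starts true k.+3 X)) addnC leq_add //.
  rewrite (_ : k + j + 2 = k.+1 + j.+1); last lia.
  apply: erdos_szekeres; rewrite ?uniq_sel//; do ?exact: total_on_sel.
    apply: chain_free_sub (@chain_free_not_starts true k.+1 X).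
    move=> p /mem_sel[np /YX pX].
    by rewrite mem_filter pX andbT; apply/asboolP.
  exact: chain_free_sub (@sel_sub _ _) (@chain_free_not_ends _ _ _).
rewrite (_ : k + j + 2 = k.+2 + j); last lia.
apply: erdos_szekeres; rewrite ?uniq_sel//; do ?exact: total_on_sel.
  by move: cupX; rewrite addn4; apply: chain_free_sub => p /mem_sel[_ /YX].
move=> s0 Hs0 /last2[s [u [p [def_s sz]]]]; subst s0.
have Hs : chain false X (s ++ [:: u; p]).
  by apply: chain_sub Hs0 => q /mem_sel[_ /YX].
have /mem_sel[[v [t [Ht sz_t]]] _] : p \in sel (starts true k.+3 X) Y.
  by rewrite (chain_mem Hs0) // mem_cat !inE eqxx !orbT.
(* A prolonged cap ends with the first edge [p v] of the cup; a prolonged cup has k + 4 points. *)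
have [Hv|Hu] := chain_junction Hs Ht.
  apply: no_edge; exists (s ++ [:: u]), p, v, t.
  by split=> //=; rewrite ?size_cat /= -?catA //=; lia.
by apply: (cupX _ Hu) => /=; lia.
Qed.

(* Scan from left to right, putting into [A] the points that end a cup of the
   points put into [B] so far. That these cups avoid [A] is what excludes [y = c1]
   in [no_shared_edge]. *)
Lemma greedy_transversal N X : sorted lt X -> exists A B,
  [/\ perm_eq (A ++ B) X, chain_free true N.+2 B &
      forall p, p \in A -> exists s u,
        [/\ chain true X (s ++ [:: u; p]), size s = N & {subset rcons s u <= B}]].
Proof.
elim/last_ind: X => [_|X p IH sX].
  exists [::], [::]; split=> // s /and3P[_ + _].
  by case: s => // a s /= /andP[].
have ltXp q : q \in X -> lt q p.
  move=> qX; move: sX; rewrite -cats1 => sX.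
  have := sX; rewrite (sorted_pairwise lt_trans) pairwise_cat => /and3P[/allrelP + _ _].
  by move=> /(_ q p qX); rewrite inE => ->.
have [|A [B [perm_X freeB cupA]]] := IH.
  by move: sX; rewrite -cats1 => /cat_sorted2[].
have BX : {subset B <= X} by move=> q qB; rewrite -(perm_mem perm_X) mem_cat qB orbT.
have Xp : {subset X <= rcons X p} by move=> q; rewrite mem_rcons inE orbC => ->.
have [[s [u [Hs sz_s sB]]]|nocup] := pselect (exists s u,
    [/\ chain true (rcons X p) (s ++ [:: u; p]), size s = N & {subset rcons s u <= B}]).
  exists (p :: A), B; split=> //.
    by rewrite /= perm_sym perm_rcons perm_cons perm_sym.
  move=> q; rewrite inE => /predU1P[->|/cupA[s' [u' [Hs' sz' sB']]]].
    by exists s, u.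
  by exists s', u'; split=> //; apply: chain_sub Hs'.
exists A, (p :: B); split.
  by rewrite -cat1s perm_catCA /= perm_sym perm_rcons perm_cons perm_sym.
  move=> s0 Hs /last2[s [u [q [def_s sz]]]]; subst s0.
  (* As [p] is the largest point, it can only be the right end of the cup, and [nocup] excludes
     that. *)
  have [pr|pr] := boolP (p \in rcons s u).
    have [sl /allP sB _] := and3P Hs; move: sl; rewrite -cat_rcons.
    rewrite (sorted_pairwise lt_trans) pairwise_cat => /and3P[/allrelP + _ _].
    move=> /(_ p q pr); rewrite inE eqxx => /(_ isT) pq.
    have := sB q; rewrite mem_cat !inE eqxx !orbT => /(_ isT) /predU1P[qp|/BX/ltXp qp].
      by rewrite qp lt_irr in pq.
    by have := lt_trans pq qp; rewrite lt_irr.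
  have sB : {subset rcons s u <= B}.
    move=> r rs; have := chain_mem Hs (_ : r \in _); rewrite -cat_rcons mem_cat rs.
    by move=> /(_ isT); rewrite inE => /predU1P[rp|//]; rewrite -rp rs in pr.
  have := chain_mem Hs (_ : q \in _); rewrite mem_cat !inE eqxx !orbT => /(_ isT).
  case/predU1P=> [qp|qB]; last first.
    apply: (freeB (s ++ [:: u; q])); last by rewrite size_cat /= sz addn2.
    case/and3P: Hs => sl _ sm; apply/and3P; split=> //; apply/allP => r.
    by rewrite -cat_rcons mem_cat inE => /orP[/sB//|/eqP->].
  apply: nocup; exists s, u; rewrite -qp; split=> //.
  apply: chain_sub Hs => r; rewrite mem_rcons !inE qp.
  by case/predU1P=> [->|/BX->]; rewrite ?eqxx ?orbT.
by move=> q /cupA[s [u [Hs sz sB]]]; exists s, u; split=> //;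
  [exact: chain_sub Hs | move=> r /sB rB; rewrite inE rB orbT].
Qed.

(* Monotonicity of orientations on four points sorted by abscissa: the signs of
   the four triples in lexicographic order change at most once. *)
Section Signotope.
Hypothesis col_trans_l : forall a b c d, lt a b -> lt b c -> lt c d ->
  col a b c -> col b c d -> col a b d.
Hypothesis col_trans_r : forall a b c d, lt a b -> lt b c -> lt c d ->
  col a b c -> col b c d -> col a c d.
Hypothesis col_switch : forall a b c d, lt a b -> lt b c -> lt c d ->
  col a c d -> ~~ col b c d -> col a b c.

Lemma chain_lt c X p q s t : chain c X (s ++ p :: t) -> q \in t -> lt p q.
Proof.
by move=> /chain_behead/and3P[/= /(order_path_min lt_trans)/allP + _ _]; apply.
Qed.

(** Let [q] be the second point. Triples [p q r] follow by [col_trans_l] from the first triple; then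
    [p q t] and [q t u] give [p t u] by [col_trans_r]. *)
Lemma cup_pairwise X p s : chain true X (p :: s) -> pairwise (col p) s.
Proof.
elim: s p => // q s IH p Hs; have Hq := chain_behead (Hs : chain _ _ ([:: p] ++ _)).
have lt_pq : lt p q by apply: (chain_lt (Hs : chain _ _ ([::] ++ _))); rewrite inE eqxx.
have lt_q r : r \in s -> lt q r by apply: (chain_lt (Hq : chain _ _ ([::] ++ _))).
have col_pq r : r \in s -> col p q r.
  case: s IH Hs Hq lt_q => // r0 s IH Hs Hq lt_q.
  have := Hs; rewrite chain_cons => /and4P[_ _ /eqP col0 _].
  rewrite inE => /predU1P[->//|rs].
  have lt_r0 := chain_lt (Hq : chain _ _ ([:: q] ++ _)) rs.
  apply: (col_trans_l lt_pq (lt_q _ (mem_head _ _)) lt_r0 col0).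
  by have /= /andP[/allP->] := IH _ Hq.
rewrite /=; apply/andP; split; first exact/allP.
have : pairwise [rel t u | lt t u && col q t u] s.
  rewrite pairwise_relI (IH _ Hq) andbT -(sorted_pairwise lt_trans).
  by case/and3P: Hq => /= /path_sorted.
apply: (sub_in_pairwise (P := [in s])); last exact/allP.
move=> t u ts us /= /andP[tu qtu].
exact: (col_trans_r lt_pq (lt_q _ ts)) (col_pq _ ts) qtu.
Qed.

Lemma cup_subseq X s s' : subseq s' s -> chain true X s -> chain true X s'.
Proof.
move=> ss' /[dup] Hs /and3P[sl /allP sX _]; apply/and3P; split.
- exact: subseq_sorted sl.
- by apply/allP => p /(mem_subseq ss')/sX.
elim: s s' ss' Hs {sl sX} => [|p s IH] [|q s'] //.
have mono_s t : chain true X (p :: s) -> subseq t s -> mono true t.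
  by move=> /(chain_behead (s := [:: p])) Hs ts; exact: IH.
rewrite /=; case: eqP => [-> ss' Hs|_ ss' Hs]; last exact: mono_s ss'.
have := mono_s _ Hs ss'; have := subseq_pairwise ss' (cup_pairwise Hs).
by case: s' ss' => [|r [|r' s']] //= _ /andP[/andP[-> _] _].
Qed.

(** * Exclusion of shared edges among the ends of long cups *)

Section SharedEdge.
Variables (k : nat) (X A B : seq T).
Hypothesis tX : total_on X.
Hypothesis cup_free : chain_free true (k + 6) X.
Hypothesis cap_free : chain_free false (k + 5) X.
(** Here n = k + 6: an (n-1)-cup from [a] to [b] and a point [v] above its chord would form an
    n-gon. The 3 counts [a], [b] and [v]. *)
Hypothesis no_gon : forall a s b v, chain true X (a :: s ++ [:: b]) ->
  size s + 3 = k + 6 -> v \in X -> lt a v -> lt v b -> col a v b.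
Hypothesis AX : {subset A <= X}.
Hypothesis AB : forall p, p \in A -> p \in B -> False.
Hypothesis A_ends : forall p, p \in A -> exists s u,
  [/\ chain true X (s ++ [:: u; p]), size s = k + 3 & {subset rcons s u <= B}].

Lemma cap_extend p q s : chain false A [:: p, q & s] ->
  exists u, chain false X [:: u, p, q & s].
Proof.
move=> Hs; have [|s' [u [Hs' sz _]]] := @A_ends p.
  by rewrite (chain_mem Hs) ?inE ?eqxx.
have [H|H] := chain_junction Hs' (chain_sub AX Hs); last by exists u.
by case: (cup_free H); rewrite size_cat sz /=; lia.
Qed.

Lemma cap_free_A : chain_free false (k + 4) A.
Proof.
move=> [|p [|q s]] Hs /=; try lia.
by move=> sz; have [u Hu] := cap_extend Hs; apply: (cap_free Hu) => /=; lia.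
Qed.

(* [y z w ..] is the cup, [.. x y z] the cap after its extension to the left, and
   [c1 c2 c3 .. z] the cup ending at [z]. Two points [a b] to the right of [y] with
   [x y a] and [y a b] caps would turn the cap without [z] into a (k+5)-cap. *)
Lemma no_shared_edge : ~ shared_edge (k + 5) (k + 3) A.
Proof.
move=> [s [y [z [t [Hcap sz_s Hcup sz_t]]]]].
have [yA zA] : y \in A /\ z \in A.
  by rewrite !(chain_mem Hcup) ?inE ?eqxx ?orbT.
have [yX zX] := (AX yA, AX zA).
case: t sz_t Hcup => [|w t] /= sz_t /(chain_sub AX) Hcup; first by lia.
(* The extended cap has k + 4 points, so replacing [z] by two points yields k + 5. *)
have [g [x [Hxyz sz_g]]] :
    exists g x, chain false X (g ++ [:: x; y; z]) /\ size g = k + 1.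
  case: s sz_s Hcap => [|d s] /= sz_s Hcap; first by lia.
  have [u] : exists u, chain false X (u :: d :: s ++ [:: y; z]).
    by case: s Hcap {sz_s} => [|d' s] /cap_extend.
  rewrite -cat1s -cat_cons catA /= => H.
  exists (belast u (d :: s)), (last u (d :: s)); split.
    by rewrite -cat_rcons -lastI.
  by rewrite size_belast /=; lia.
move: (Hxyz); rewrite chain_rcons => /and4P[_ lt_yz /eqP xyz Hxy].
have lt_xy : lt x y by apply: (chain_lt Hxy); rewrite inE eqxx.
move: (Hcup); rewrite chain_cons => /and4P[_ _ /eqP yzw Hzw].
have lt_zw : lt z w.
  by apply: (chain_lt (Hcup : chain _ _ ([:: y] ++ _))); rewrite inE eqxx.
have no_cap a b : a \in X -> b \in X -> lt y a -> lt a b ->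
    ~~ col x y a -> ~~ col y a b -> False.
  move=> aX bX ya ab /negbTE xya /negbTE yab.
  apply: (cap_free (s := g ++ [:: x; y; a; b])); last by rewrite size_cat sz_g -addnA.
  rewrite -[g ++ _]/(g ++ [:: x] ++ [:: y; a; b]) catA chain_rcons -catA bX ab yab /=.
  by rewrite chain_rcons aX ya xya Hxy.
have [s' [q [Hc sz_c cB]]] := A_ends zA.
have [c1 [c2 [c3 [s3 def_s']]]] : exists c1 c2 c3 s3, s' = [:: c1, c2, c3 & s3].
  case: s' sz_c {Hc cB} => [|c1 [|c2 [|c3 s3]]] /= sz_c; last by exists c1, c2, c3, s3.
  - by exfalso; move: sz_c; clear; lia.
  - by exfalso; move: sz_c; clear; lia.
  - by exfalso; move: sz_c; clear; lia.
move: def_s' sz_c Hc cB => -> {s'} /= sz_c Hc cB.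
have c1X : c1 \in X by apply: (chain_mem Hc); rewrite inE eqxx.
have c2X : c2 \in X by apply: (chain_mem Hc); rewrite !inE eqxx ?orbT.
have c3X : c3 \in X by apply: (chain_mem Hc); rewrite !inE eqxx ?orbT.
have lt12 : lt c1 c2.
  by apply: (chain_lt (Hc : chain _ _ ([::] ++ _))); rewrite inE eqxx.
have lt23 : lt c2 c3.
  by apply: (chain_lt (Hc : chain _ _ ([:: c1] ++ _))); rewrite inE eqxx.
have lt2z : lt c2 z.
  apply: (chain_lt (Hc : chain _ _ ([:: c1] ++ _))).
  by rewrite inE mem_cat !inE eqxx !orbT.
have lt1z := lt_trans lt12 lt2z.
have y_c1 : y != c1.
  by apply/eqP => yc; apply: (AB yA); rewrite yc cB ?inE ?eqxx.
have lt_yc1 : lt y c1.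
  (* If [y] were between [c1] and [z], [no_gon] would put it below their chord, and [c1] could be
     prepended to the cup [y z w ..]. *)
  case/orP: (tX yX c1X y_c1) => // lt_c1y.
  case: (cup_free (s := [:: c1, y, z, w & t])); last first.
    by rewrite /=; move: sz_t; clear; lia.
  rewrite chain_cons Hcup c1X lt_c1y andbT /= eqb_id.
  apply: (no_gon (s := [:: c2, c3 & rcons s3 q])) => //=; last first.
    by rewrite size_rcons; move: sz_c; clear; lia.
  by rewrite cat_rcons.
have lt_yc2 := lt_trans lt_yc1 lt12.
have c12z : col c1 c2 z.
  have := cup_pairwise Hc; rewrite pairwise_cons => /andP[/allP c12 _].
  by apply: c12; rewrite inE mem_cat !inE eqxx !orbT.
have yc12 : ~~ col y c1 c2.
  apply/negP => yc12; apply: (cup_free (s := [:: y, c1, c2, c3 & s3 ++ [:: q; z]])).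
    by rewrite chain_cons yX lt_yc1 yc12.
  by rewrite /= size_cat /=; move: sz_c; clear; lia.
have c2zw : ~~ col c2 z w.
  apply/negP => c2zw; apply: (cup_free (s := [:: c1, c2, z, w & t])).
    by rewrite chain_cons c1X lt12 c12z chain_cons c2X lt2z c2zw.
  by rewrite /=; move: sz_t; clear; lia.
(* The edge [y a] is less steep than [y z], which is less steep than [x y]. *)
have above a : lt y a -> lt a z -> col y a z -> ~~ col x y a.
  move=> ya az yaz; apply/negP => xya.
  by rewrite (col_trans_l lt_xy ya az xya yaz) in xyz.
have yc2z := col_switch lt_yc2 lt2z lt_zw yzw c2zw.
have yc23 : col y c2 c3.
  by apply/negPn/negP; apply: no_cap (above _ _ _ yc2z).
(* Replacing [c1] by [y] in the cup leaves an (n-1)-cup, so [c1] is not above the chord [y z]. *)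
have yc1z : col y c1 z.
  apply: (no_gon (s := [:: c2, c3 & rcons s3 q])) => //.
    move: Hc; rewrite cat_cons chain_cons => /and4P[_ _ _ Hc].
    by rewrite /= cat_rcons chain_cons yX lt_yc2 yc23.
  by rewrite /= size_rcons; move: sz_c; clear; lia.
exact: no_cap c1X c2X lt_yc1 lt12 (above _ lt_yc1 lt1z yc1z) yc12.
Qed.

End SharedEdge.

(** * The bound for abstract orientations *)

Theorem cups_caps_gons_bound k X : sorted lt X -> total_on X ->
  chain_free true (k + 6) X -> chain_free false (k + 5) X ->
  (forall a s b v, chain true X (a :: s ++ [:: b]) ->
    size s + 3 = k + 6 -> v \in X -> lt a v -> lt v b -> col a v b) ->
  size X <= 'C(k + 3 + (k + 3), k + 3) + g (k + 6) (k + 4).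
Proof.
move=> sX tX cupX capX no_gon.
have [A [B [perm_X cupB cupA]]] := greedy_transversal (k + 3) sX.
have := sorted_uniq lt_trans lt_irr sX; rewrite -(perm_uniq perm_X) cat_uniq.
case/and3P=> uA /hasPn disjAB uB.
have AX : {subset A <= X} by move=> p pA; rewrite -(perm_mem perm_X) mem_cat pA.
have BX : {subset B <= X} by move=> p pB; rewrite -(perm_mem perm_X) mem_cat pB orbT.
have AB p : p \in A -> p \in B -> False by move=> pA /disjAB; rewrite /= pA.
have e5 : (k + 3).+2 = k + 5 by rewrite -addn2 -addnA.
rewrite -(perm_size perm_X) size_cat addnC leq_add //.
  apply: erdos_szekeres => //; first exact: total_on_sub tX.
  by rewrite e5; apply: chain_free_sub capX.
apply: leq_trans (g_lower k).
(* [A] has no (k+6)-cup and no (k+4)-cap, whence the parameters k + 2 and k. *)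
have := @shared_edge_bound (k + 2) k A uA (total_on_sub AX tX).
have -> : k + 2 + 4 = k + 6 by rewrite -addnA.
have -> : k + 2 + 3 = k + 5 by rewrite -addnA.
have -> : k + 2 + k + 2 = k.*2 + 4 by rewrite -addnn; clear; lia.
have -> : (k + 2).+1 = k + 3 by rewrite -addn1 -addnA.
have -> : (k + 3).+1 = k + 4 by rewrite -addn1 -addnA.
apply.
- exact: chain_free_sub cupX.
- exact: (cap_free_A cupX capX AX cupA).
- exact: (no_shared_edge tX cupX capX no_gon AX AB cupA).
Qed.

End Signotope.

End MonochromaticChains.

(** * Points of the plane *)

Local Open Scope ring_scope.

Section PlaneChains.
Variable R : realType.
Implicit Types (p q r t : 'rV[R]_2) (S : {fset 'rV[R]_2}).

Definition ltx p q := xcoord p < xcoord q.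

(* Twice the signed area of the triangle [p q r]. *)
Definition area p q r : R :=
  (xcoord q - xcoord p) * (ycoord r - ycoord p) -
  (ycoord q - ycoord p) * (xcoord r - xcoord p).

(** Collinear triples get the colour of caps; [area_neq0] rules them out in general position. *)
Definition ccw p q r := 0 < area p q r.

Lemma ltx_trans : transitive ltx.
Proof. by move=> q p r; apply: lt_trans. Qed.

Lemma ltx_irr : irreflexive ltx.
Proof. by move=> p; apply: ltxx. Qed.

(** Up to a positive factor, [area p q t] is a positive combination of [area p q r] and
    [area q r t]. *)
Lemma ccw_trans_l p q r t : ltx p q -> ltx q r -> ltx r t ->
  ccw p q r -> ccw q r t -> ccw p q t.
Proof.
rewrite /ltx /ccw => pq qr rt pqr qrt.
rewrite -(pmulr_rgt0 _ (_ : 0 < xcoord r - xcoord q)) ?subr_gt0//.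
rewrite (_ : _ * _ = (xcoord t - xcoord q) * area p q r +
                     (xcoord q - xcoord p) * area q r t); last by rewrite /area; ring.
by apply: addr_gt0; apply: mulr_gt0; rewrite // subr_gt0 // (lt_trans qr).
Qed.

Lemma area_decomp p q r t : (xcoord r - xcoord q) * area p r t =
  (xcoord t - xcoord r) * area p q r + (xcoord r - xcoord p) * area q r t.
Proof. by rewrite /area; ring. Qed.

Lemma ccw_trans_r p q r t : ltx p q -> ltx q r -> ltx r t ->
  ccw p q r -> ccw q r t -> ccw p r t.
Proof.
rewrite /ltx /ccw => pq qr rt pqr qrt.
rewrite -(pmulr_rgt0 _ (_ : 0 < xcoord r - xcoord q)) ?subr_gt0// area_decomp.
by apply: addr_gt0; apply: mulr_gt0; rewrite // subr_gt0 // (lt_trans pq).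
Qed.

Lemma ccw_switch p q r t : ltx p q -> ltx q r -> ltx r t ->
  ccw p r t -> ~~ ccw q r t -> ccw p q r.
Proof.
rewrite /ltx /ccw -leNgt => pq qr rt prt qrt.
rewrite -(pmulr_rgt0 _ (_ : 0 < xcoord t - xcoord r)) ?subr_gt0//.
have := area_decomp p q r t; move/esym/(canRL (addrK _)) => ->.
rewrite subr_gt0; apply: (@le_lt_trans _ _ 0); last by rewrite mulr_gt0 // subr_gt0.
by apply: mulr_ge0_le0; rewrite // subr_ge0 ltW // (lt_trans pq).
Qed.

(** * Slopes and orientations *)

Lemma slope_ltE p q r : ltx p q -> ltx q r ->
  (slope p q < slope q r) = (0 < area p q r).
Proof.
rewrite /ltx -subr_gt0 => pq; rewrite -subr_gt0 => qr.
rewrite /slope ltr_pdivrMr// mulrAC ltr_pdivlMr// -subr_gt0.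
by congr (0 < _); rewrite /area; ring.
Qed.

Lemma slope_gtE p q r : ltx p q -> ltx q r ->
  (slope p q > slope q r) = (area p q r < 0).
Proof.
rewrite /ltx -subr_gt0 => pq; rewrite -subr_gt0 => qr.
rewrite /slope ltr_pdivrMr// mulrAC ltr_pdivlMr// -subr_lt0.
by congr (_ < 0); rewrite /area; ring.
Qed.

Lemma area_neq0 S p q r : general_position S -> p \in S -> q \in S -> r \in S ->
  ltx p q -> ltx q r -> area p q r != 0.
Proof.
move=> gpS pS qS rS pq qr; apply/eqP => area0.
apply: (gpS p q r pS qS rS).
  rewrite /= !inE negb_or andbT; apply/andP; split; last first.
    by apply/eqP => e; rewrite /ltx e ltxx in qr.
  apply/andP; split; apply/eqP => e; first by rewrite /ltx e ltxx in pq.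
  by have := ltx_trans pq qr; rewrite /ltx e ltxx.
(* The line through [p] and [q], which is not vertical. *)
exists (ycoord p - ycoord q), (xcoord q - xcoord p),
  ((ycoord p - ycoord q) * xcoord p + (xcoord q - xcoord p) * ycoord p).
split; first by right; rewrite subr_eq0 gt_eqF.
move=> t; rewrite !inE => /or3P[] /eqP-> //; first by ring.
by apply/eqP; rewrite -subr_eq0 -area0; apply/eqP; rewrite /area; ring.
Qed.

Lemma chain_cup S s : chain ltx ccw true S s ->
  is_cup (size s) [fset t in s]%fset.
Proof.
move=> /and3P[sl _ sm]; exists s; split=> //.
  by split=> // t; rewrite inE.
elim: s sl sm => [|p [|q [|r s]] IH] //= /and3P[pq qr sl] /andP[/eqP col sm].
rewrite slope_ltE//; apply/andP; split; first by rewrite [_ < _]col.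
by apply: IH; rewrite ?sm //= qr.
Qed.

Lemma chain_cap S s : general_position S -> chain ltx ccw false S s ->
  is_cap (size s) [fset t in s]%fset.
Proof.
move=> gpS /and3P[sl /allP sS sm]; exists s; split=> //.
  by split=> // t; rewrite inE.
elim: s sl sS sm => [|p [|q [|r s]] IH] //= /and3P[pq qr sl] sS /andP[/eqP col sm].
rewrite slope_gtE//; apply/andP; split; last first.
  by apply: IH; rewrite ?sm //= ?qr // => t ts; apply: sS; rewrite inE ts orbT.
rewrite lt_neqAle (area_neq0 gpS) ?sS ?inE ?eqxx ?orbT //=.
by rewrite leNgt; apply/negbT.
Qed.

(** * Convex position by separating lines *)

Lemma convex_halfplane (a b c : R) :
  convex_set [set t : 'rV[R]_2 | c < a * xcoord t + b * ycoord t]%classic.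
Proof.
apply/convex_setW => p q; rewrite !inE /= => pc qc l l0 l1.
rewrite inE /= /conv /=; set k := Itv.r l.
rewrite [ltRHS](_ : _ = k * (a * xcoord p + b * ycoord p)
                      + (1 - k) * (a * xcoord q + b * ycoord q)); last first.
  by rewrite /xcoord /ycoord !mxE /unstable.onem; ring.
rewrite (_ : c = k * c + (1 - k) * c); last by ring.
by rewrite ltrD // ltr_pM2l // subr_gt0.
Qed.

(** The open half-plane where the linear form exceeds its value at [p] is convex and contains the
    other points, but not [p]. *)
Lemma separated_not_in_hull (T : {fset 'rV[R]_2}) p (a b : R) :
  (forall t, t \in T -> t != p ->
     a * xcoord p + b * ycoord p < a * xcoord t + b * ycoord t) ->
  ~ convex_hull [set q | q \in (T `\ p)%fset]%classic p.
Proof.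
move=> sep hull.
have := smallest_sub (@convex_halfplane a b (a * xcoord p + b * ycoord p)) _ hull.
rewrite /= ltxx => H; suff: false by []; apply: H => t /=.
by rewrite in_fsetD1 => /andP[tp tT]; exact: sep.
Qed.

(** Each point is separated from the others: [v] by a parallel to the chord [a b], an inner point of
    the cup by a parallel to the line through its two neighbours, [a] and [b] by vertical lines. *)
Lemma cup_above_chord_gon S a s b v : chain ltx ccw true S (a :: s ++ [:: b]) ->
  v \in S -> ltx a v -> ltx v b -> area a v b < 0 ->
  is_convex_gon (size s + 3) [fset t in v :: a :: s ++ [:: b]]%fset.
Proof.
move=> HK vS av vb avb.
have ab := ltx_trans av vb.
have triple t u w : subseq [:: t; u; w] (a :: s ++ [:: b]) -> ccw t u w.
  move=> /(cup_subseq ltx_trans ccw_trans_l ccw_trans_r)/(_ HK)/and3P[_ _ /=].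
  by rewrite andbT => /eqP.
have a_lt t : t \in s ++ [:: b] -> ltx a t.
  exact: (chain_lt ltx_trans (HK : chain _ _ _ _ ([::] ++ _))).
have lt_b t : t \in a :: s -> ltx t b.
  move=> ts; case/and3P: HK => + _ _; rewrite -cat_cons (sorted_pairwise ltx_trans).
  by rewrite pairwise_cat => /and3P[/allrelP + _ _]; apply; rewrite ?inE.
have vK : v \notin a :: s ++ [:: b].
  rewrite inE mem_cat inE !negb_or; apply/and3P; split.
  - by apply/eqP => va; rewrite va ltx_irr in av.
  - apply/negP => vs; suff : ccw a v b by rewrite /ccw ltNge ltW.
    apply: triple.
    apply: (@cat_subseq _ [:: a] ([:: v] ++ [:: b]) [:: a] (s ++ [:: b])).
      exact: subseq_refl.
    by apply: cat_subseq; rewrite sub1seq ?inE.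
  - by apply/eqP => vb'; rewrite vb' ltx_irr in vb.
split.
  rewrite card_fseq undup_id; first by rewrite /= size_cat addn1 addn3.
  by rewrite cons_uniq vK (chain_uniq ltx_trans ltx_irr HK).
have sep_area p u w : (forall t, t \in v :: a :: s ++ [:: b] -> t != p ->
    area u w p < area u w t) ->
    ~ convex_hull
        [set q | q \in ([fset t in v :: a :: s ++ [:: b]] `\ p)%fset]%classic p.
  (* [area u w] is affine in its last argument, with these linear coefficients. *)
  move=> sep; apply: (@separated_not_in_hull _ _ (ycoord u - ycoord w)
                                                (xcoord w - xcoord u)).
  move=> t; rewrite in_fset => tK /(sep _ tK).
  rewrite -subr_gt0 => H; rewrite -subr_gt0; move: H; congr (0 < _).
  by rewrite /area; ring.
have ends t : t \in a :: s ++ [:: b] -> 0 <= area a t b.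
  rewrite inE mem_cat inE => /or3P[/eqP->|ts|/eqP->].
  - by rewrite (_ : area a a b = 0) // /area; ring.
  - apply/ltW/triple.
    apply: (@cat_subseq _ [:: a] ([:: t] ++ [:: b]) [:: a] (s ++ [:: b])).
      exact: subseq_refl.
    by apply: cat_subseq; rewrite sub1seq ?inE.
  - by rewrite (_ : area a b b = 0) // /area; ring.
have area_rot t u w : area t u w = area w t u by rewrite /area; ring.
move=> p; rewrite in_fset inE => /predU1P[->|].
  apply: (sep_area _ b a) => t; rewrite inE => /predU1P[->|/ends tK _].
    by rewrite eqxx.
  by rewrite -(area_rot a v b) -(area_rot a t b); exact: lt_le_trans tK.
rewrite inE mem_cat inE => /or3P[/eqP->|ps|/eqP->].
- apply: (@separated_not_in_hull _ _ 1 0) => t.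
  rewrite !mul1r !mul0r !addr0 in_fset 2!inE => /or3P[/eqP->//|/eqP->|/a_lt //].
  by rewrite eqxx.
(* [u] and [w] are the neighbours of [p] in the cup, possibly [a] and [b]. *)
- have [s1 [u [w [s2 defK]]]] : exists s1 u w s2,
      a :: s ++ [:: b] = s1 ++ [:: u; p; w] ++ s2.
    case/splitPr: ps => s1 s2.
    have [w [s3 e]] : exists w s3, s2 ++ [:: b] = w :: s3.
      by case: s2 => [|w s2]; [exists b, [::] | exists w, (s2 ++ [:: b])].
    exists (belast a s1), (last a s1), w, s3.
    by rewrite -catA /= e -cat_cons lastI cat_rcons.
  have upw : ccw u p w.
    apply: triple; rewrite defK; apply: subseq_trans (suffix_subseq _ _).
    exact: (prefix_subseq [:: u; p; w]).
  have uwK t : t \in a :: s ++ [:: b] -> t != p -> 0 <= area u w t.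
    rewrite defK !mem_cat => + tp; rewrite !inE (negbTE tp) /=.
    case/or3P => [t1|/orP[/eqP->|/eqP->]|t2].
    + rewrite area_rot; apply/ltW/triple; rewrite defK.
      apply: (@cat_subseq _ [:: t] [:: u; w]); first by rewrite sub1seq.
      apply: subseq_trans (prefix_subseq [:: u; p; w] _).
      by apply/subseqP; exists [:: true; false; true].
    + by rewrite (_ : area u w u = 0) // /area; ring.
    + by rewrite (_ : area u w w = 0) // /area; ring.
    + apply/ltW/triple; rewrite defK; apply: subseq_trans (suffix_subseq _ _).
      apply: (@cat_subseq _ [:: u; w] [:: t]); last by rewrite sub1seq.
      by apply/subseqP; exists [:: true; false; true].
  apply: (sep_area _ u w) => t.
  have p_neg : area u w p < 0.
    by rewrite (_ : area u w p = - area u p w) ?oppr_lt0 // /area; ring.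
  rewrite inE => /predU1P[->|tK] tp; last exact: lt_le_trans p_neg (uwK _ tK tp).
  apply: lt_trans p_neg _.
  have pa : ltx a p by rewrite a_lt // mem_cat ps.
  have pb : ltx p b by rewrite lt_b // inE ps orbT.
  have uw : ltx u w.
    have := HK; rewrite defK => /(@chain_behead _ _ _ _ _ s1)/and3P[/= + _ _].
    by case/and3P=> up pw _; exact: ltx_trans pw.
  rewrite -(pmulr_rgt0 _ (_ : 0 < xcoord b - xcoord a)) ?subr_gt0 //.
  (* The line [u w] is below [a] and [b], hence below the chord [a b] and [v]. *)
  rewrite [ltRHS](_ : _ = (xcoord b - xcoord v) * area u w a
     + (xcoord v - xcoord a) * area u w b - (xcoord w - xcoord u) * area a v b);
    last by rewrite /area; ring.
  rewrite subr_gt0; apply: (@lt_le_trans _ _ 0).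
    by rewrite pmulr_rlt0 // subr_gt0.
  have a_ge : 0 <= area u w a.
    by apply: uwK; rewrite ?inE ?eqxx //; apply/eqP => e; rewrite e ltx_irr in pa.
  have b_ge : 0 <= area u w b.
    apply: uwK; rewrite ?inE ?mem_cat ?inE ?eqxx ?orbT //.
    by apply/eqP => e; rewrite e ltx_irr in pb.
  by apply: addr_ge0; apply: mulr_ge0; rewrite // subr_ge0 ltW.
- apply: (@separated_not_in_hull _ _ (-1) 0) => t.
  rewrite !mulN1r !mul0r !addr0 ltrN2 in_fset inE -cat_cons mem_cat mem_seq1.
  by move=> /or3P[/eqP->//|/lt_b //|/eqP->]; rewrite eqxx.
Qed.
End PlaneChains.

(** * Application to a planar point set *)

Theorem theorem4 (R : realType) (n : nat) (S : {fset 'rV[R]_2})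
    (hn : (6 <= n)%N)
    (hgp : general_position S)
    (hx : distinct_xcoords S)
    (hS : #|` S|%fset = ('C(2 * n - 6, n - 3) + g n (n - 2) + 1)%N) :
  exists T : {fset 'rV[R]_2}, (T `<=` S)%fset /\
    (is_cup n T \/ is_cap (n - 1) T \/ is_convex_gon n T).
Proof.
apply: contrapT => none.
have subS s : {subset s <= S} -> ([fset t in s] `<=` S)%fset.
  by move=> sS; apply/fsubsetP => t; rewrite in_fset; exact: sS.
pose leX (p q : 'rV[R]_2) := xcoord p <= xcoord q.
set X := sort leX (enum_fset S).
have XS : X =i S by move=> t; rewrite mem_sort.
have XsubS : {subset X <= S} by move=> t; rewrite XS.
have [k def_n] : exists k, n = (k + 6)%N by exists (n - 6)%N; rewrite subnK.
have tX : total_on (@ltx R) X.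
  move=> p q; rewrite !XS => pS qS pq; rewrite /ltx -neq_lt.
  by apply: contra pq => /eqP/hx-> //.
(* Sorting gives the weak order; distinct points have distinct abscissae, which makes it strict. *)
have sX : sorted (@ltx R) X.
  rewrite (sorted_pairwise (@ltx_trans R)); have /= := sort_uniq leX (enum_fset S).
  rewrite fset_uniq -/X uniq_pairwise => ux.
  have := sort_sorted (leT := leX) (fun p q => le_total _ _) (enum_fset S).
  rewrite (sorted_pairwise) => [lex|q p r]; last exact: le_trans.
  have : pairwise [rel p q | leX p q && (p != q)] X by rewrite pairwise_relI lex.
  apply: (sub_in_pairwise (P := [in X])); last exact/allP.
  move=> p q pX qX /= /andP[pq p_q]; rewrite /ltx lt_neqAle -/(leX p q) pq andbT.
  by apply: contra p_q => /eqP/hx-> //; exact: XsubS.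
have sizeX : size X = #|` S|%fset by rewrite size_sort.
have := @cups_caps_gons_bound _ (@ltx R) (@ccw R) (@ltx_trans R) (@ltx_irr R)
  (@ccw_trans_l R) (@ccw_trans_r R) (@ccw_switch R) k X sX tX.
have -> : (k + 3 + (k + 3) = 2 * n - 6)%N by rewrite def_n; lia.
have -> : (k + 3 = n - 3)%N by rewrite def_n; lia.
have -> : (k + 4 = n - 2)%N by rewrite def_n; lia.
have -> : (k + 5 = n - 1)%N by rewrite def_n; lia.
rewrite -def_n sizeX hS => bound.
suff: (('C(2 * n - 6, n - 3) + g n (n - 2)).+1 <= 'C(2 * n - 6, n - 3) + g n (n - 2))%N.
  by rewrite ltnn.
rewrite -addn1; apply: bound.
- move=> s /(chain_sub XsubS) Hs sz; apply: none; exists [fset t in s]%fset.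
  split; first by apply: subS => t; exact: chain_mem Hs.
  by left; rewrite -sz; exact: chain_cup Hs.
- move=> s /(chain_sub XsubS) Hs sz; apply: none; exists [fset t in s]%fset.
  split; first by apply: subS => t; exact: chain_mem Hs.
  by right; left; rewrite -sz; exact: chain_cap Hs.
- move=> a s b v /(chain_sub XsubS) Hs sz /XsubS vS av vb; apply/negPn/negP => avb.
  have KS t : t \in v :: a :: s ++ [:: b] -> t \in S.
    by rewrite inE => /predU1P[->//|]; exact: chain_mem Hs.
  apply: none; exists [fset t in v :: a :: s ++ [:: b]]%fset.
  split; first exact: subS.
  right; right; rewrite -sz; apply: (cup_above_chord_gon Hs vS av vb).
  have aS : a \in S by apply: KS; rewrite !inE eqxx orbT.
  have bS : b \in S by apply: KS; rewrite !inE mem_cat !inE eqxx !orbT.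
  (* Not being a left turn only gives area at most 0; general position makes it negative. *)
  by rewrite lt_neqAle (area_neq0 hgp aS vS bS av vb) leNgt.
Qed.
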